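(* Let $P$ be a unary predicate symbol. Then the formula $$\big(\forall x((\neg\neg P(x) \to \forall x\,\neg\neg P(x)) \to \forall x\,\neg\neg P(x))\big) \to \forall x\,\neg\neg P(x)$$ is a theorem of intuitionistic first-order predicate logic $\mathsf{IQC}$. Consequently, the formula $$\big(\forall x((P(x) \to \forall x\,P(x)) \to \forall x\,P(x))\big) \to \forall x\,P(x)$$ belongs to $\mathsf{InqBQ}$.
   Context: Language: a countably infinite set $\mathsf{Var}$ of individual variables and a countably infinite set $\mathsf{Pred}$ of predicate symbols, each with a fixed arity $m\ge 0$ (no identity, constants or function symbols). Formulas: $\varphi ::= P(x_1,\dots,x_m)\mid \bot\mid \varphi\to\varphi\mid\varphi\wedge\varphi\mid \varphi\veebar\varphi\mid \forall x\varphi\mid \bar\exists x\varphi$, where $\veebar$ is inquisitive disjunction and $\bar\exists$ the inquisitive existential quantifier; $\neg\varphi:=\varphi\to\bot$. A relational information model is $\mathfrak M=(W,D,\mathfrak I)$ with $W$ a nonempty set (worlds), $D$ a nonempty set (individuals), and $\mathfrak I$ assigning to each $m$-ary $P$ and each $w\in W$ a set $\mathfrak I(P,w)\subseteq D^m$. A state is any $s\subseteq W$. For $g:\mathsf{Var}\to D$, support is defined by: $\mathfrak M,s\Vdash_g P(x_1,\dots,x_m)$ iff $(g(x_1),\dots,g(x_m))\in\mathfrak I(P,w)$ for all $w\in s$; $\mathfrak M,s\Vdash_g\bot$ iff $s=\varnothing$; $\wedge$ pointwise; $\mathfrak M,s\Vdash_g\varphi\to\psi$ iff for all $t\subseteq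 s$, $\mathfrak M,t\Vdash_g\varphi$ implies $\mathfrak M,t\Vdash_g\psi$; $\mathfrak M,s\Vdash_g\varphi\veebar\psi$ iff $\mathfrak M,s\Vdash_g\varphi$ or $\mathfrak M,s\Vdash_g\psi$; $\mathfrak M,s\Vdash_g\forall x\varphi$ iff $\mathfrak M,s\Vdash_{g[x\mapsto d]}\varphi$ for all $d\in D$; $\mathfrak M,s\Vdash_g\bar\exists x\varphi$ iff $\mathfrak M,s\Vdash_{g[x\mapsto d]}\varphi$ for some $d\in D$. $\mathsf{InqBQ}$ is the set of formulas $\varphi$ such that $\mathfrak M,s\Vdash_g\varphi$ for every relational information model $\mathfrak M$, every assignment $g$ and every state $s$. In the intuitionistic statement, formulas are read with $\veebar,\bar\exists$ playing no role (the formula involves only $\to,\neg,\forall$). *)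

(* Defs.v *)
From Stdlib Require List.
From mathcomp Require Import all_boot.
From mathcomp Require Import boolp classical_sets cardinality.

Set Implicit Arguments.
Unset Strict Implicit.
Unset Printing Implicit Defensive.

Local Open Scope classical_set_scope.

Record language := Language {
  var : countType;
  pred_sym : countType;
  arity : pred_sym -> nat;
  var_infinite : infinite_set [set: var];
  pred_infinite : infinite_set [set: pred_sym] }.

Arguments arity {l} p.

Section Syntax.
Variable L : language.

(* [Or] and [Ex] are inquisitive disjunction and the inquisitive existential;
   the calculus [iqc] below reads them as the intuitionistic ones. *)
Inductive form : Type :=
| Atom (p : pred_sym L) of (arity p).-tuple (var L)
| Bot
| Imp of form & form
| And of form & form
| Or of form & form
| All of var L & form
| Ex of var L & form.

Definition Neg (a : form) : form := Imp a Bot.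

Definition Atom1 (p : pred_sym L) (hp : arity p = 1) (x : var L) : form :=
  Atom (tcast (esym hp) [tuple x]).

Fixpoint free (x : var L) (a : form) : bool :=
  match a with
  | Atom _ ts => x \in tval ts
  | Bot => false
  | Imp b c | And b c | Or b c => free x b || free x c
  | All z b | Ex z b => (x != z) && free x b
  end.

(* Replaces the free occurrences of [x] by [y] without renaming bound
   variables, so it is only meaningful under [free_for y x a]. *)
Fixpoint subst (x y : var L) (a : form) : form :=
  match a with
  | Atom _ ts => Atom (map_tuple (fun z => if z == x then y else z) ts)
  | Bot => Bot
  | Imp b c => Imp (subst x y b) (subst x y c)
  | And b c => And (subst x y b) (subst x y c)
  | Or b c => Or (subst x y b) (subst x y c)
  | All z b => All z (if z == x then b else subst x y b)
  | Ex z b => Ex z (if z == x then b else subst x y b)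
  end.

(* No free occurrence of [x] in [a] lies in the scope of a quantifier
   binding [y]. *)
Fixpoint free_for (y x : var L) (a : form) : bool :=
  match a with
  | Atom _ _ | Bot => true
  | Imp b c | And b c | Or b c => free_for y x b && free_for y x c
  | All z b | Ex z b =>
      ~~ free x (All z b) || ((z != y) && free_for y x b)
  end.

(* Natural deduction for intuitionistic first-order logic. *)
Inductive iqc : seq form -> form -> Prop :=
| iqc_ax G a : List.In a G -> iqc G a
| iqc_botE G a : iqc G Bot -> iqc G a
| iqc_impI G a b : iqc (a :: G) b -> iqc G (Imp a b)
| iqc_impE G a b : iqc G (Imp a b) -> iqc G a -> iqc G b
| iqc_andI G a b : iqc G a -> iqc G b -> iqc G (And a b)
| iqc_andEl G a b : iqc G (And a b) -> iqc G a
| iqc_andEr G a b : iqc G (And a b) -> iqc G b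
| iqc_orIl G a b : iqc G a -> iqc G (Or a b)
| iqc_orIr G a b : iqc G b -> iqc G (Or a b)
| iqc_orE G a b c :
    iqc G (Or a b) -> iqc (a :: G) c -> iqc (b :: G) c -> iqc G c
| iqc_allI G x a :
    all (fun b => ~~ free x b) G -> iqc G a -> iqc G (All x a)
| iqc_allE G x y a : free_for y x a -> iqc G (All x a) -> iqc G (subst x y a)
| iqc_exI G x y a : free_for y x a -> iqc G (subst x y a) -> iqc G (Ex x a)
| iqc_exE G x a c :
    all (fun b => ~~ free x b) G -> ~~ free x c ->
    iqc G (Ex x a) -> iqc (a :: G) c -> iqc G c.

Definition IQC : set form := [set a | iqc [::] a].

Record model := Model {
  world : Type;
  indiv : Type;
  world_inhabited : inhabited world;
  indiv_inhabited : inhabited indiv;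
  interp : forall p : pred_sym L, world -> set ((arity p).-tuple indiv) }.

Definition upd (D : Type) (g : var L -> D) (x : var L) (d : D) : var L -> D :=
  fun z => if z == x then d else g z.

Fixpoint supports (M : model) (s : set (world M)) (g : var L -> indiv M)
    (a : form) : Prop :=
  match a with
  | Atom p ts => forall w, s w -> interp w (map_tuple g ts)
  | Bot => s = set0
  | Imp b c => forall t, t `<=` s -> supports t g b -> supports t g c
  | And b c => supports s g b /\ supports s g c
  | Or b c => supports s g b \/ supports s g c
  | All x b => forall d, supports s (upd g x d) b
  | Ex x b => exists d, supports s (upd g x d) b
  end.

Definition InqBQ : set form :=
  [set a | forall (M : model) (g : var L -> indiv M) (s : set (world M)),
             supports s g a].

End Syntax.

Arguments Bot {L}.

Declare Scope inq_scope.
Delimit Scope inq_scope with inq.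
Bind Scope inq_scope with form.
Notation "a ~> b" := (Imp a b) (at level 55, right associativity) : inq_scope.

(* Main.v *)
(** Intuitionistically, assume [~P x]. Then [~~P x] implies anything, in
    particular [forall x, ~~P x], so the premise at [x] yields
    [forall x, ~~P x], contradicting [~P x].
    In inquisitive semantics atoms are truth-conditional (support at a state is
    support at each of its worlds), so the same argument runs at each singleton
    state, where [P x] behaves as [~~P x]: if [P x] fails at [w], then the only
    substate of [{w}] supporting [P x] is the empty one. *)
Require Import Defs.
From mathcomp Require Import all_boot.
From mathcomp Require Import boolp classical_sets.

Set Implicit Arguments.
Unset Strict Implicit.
Unset Printing Implicit Defensive.

Local Open Scope classical_set_scope.

Section Casari.
Variable L : language.
Implicit Types (x : var L) (a b : form L) (G : seq (form L)).

Definition Casari x a : form L :=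
  Imp (All x (Imp (Imp a (All x a)) (All x a))) (All x a).

Lemma subst_id x a : subst x x a = a.
Proof.
elim: a => [p ts| |b IHb c IHc|b IHb c IHc|b IHb c IHc|z b IHb|z b IHb] //=;
  rewrite ?IHb ?IHc ?if_same //.
congr Atom; apply: eq_from_tnth => i; rewrite tnth_map.
by case: eqP.
Qed.

(** An inner quantifier over [x] leaves no free [x], so nothing is captured. *)
Lemma free_for_refl x a : free_for x x a.
Proof.
elim: a => //= [b -> c ->|b -> c ->|b -> c ->|z b ->|z b ->] //;
  by rewrite (eq_sym z) andbT; case: (x == z); rewrite ?orbT.
Qed.

(** The derivation below instantiates only at the bound variable itself. *)
Lemma iqc_allE_id G x a : iqc G (All x a) -> iqc G a.
Proof.
by move=> h; rewrite -(subst_id x a); apply: iqc_allE h; apply: free_for_refl.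
Qed.

Lemma Casari_NegNeg_IQC x a : IQC (Casari x (Neg (Neg a))).
Proof.
apply: iqc_impI; apply: iqc_allI; first by rewrite /= eqxx.
apply: iqc_impI; set G := (G in iqc G _).
have Na : iqc G (Neg a) by apply: iqc_ax; left.
apply: iqc_impE (Na); apply: (@iqc_allE_id _ x).
apply: (@iqc_impE _ _ (Imp (Neg (Neg a)) (All x (Neg (Neg a))))).
  by apply: (@iqc_allE_id _ x); apply: iqc_ax; right; left.
apply: iqc_impI; apply: iqc_botE; apply: (@iqc_impE _ _ (Neg a)).
  by apply: iqc_ax; left.
by apply: iqc_ax; right; left.
Qed.

Definition truth_conditional a : Prop :=
  forall (M : model L) (g : var L -> indiv M) (s : set (world M)),
    supports s g a <-> (forall w, s w -> supports [set w] g a).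

Lemma truth_conditional_Atom (p : pred_sym L) (ts : (arity p).-tuple (var L)) :
  truth_conditional (Atom ts).
Proof.
move=> M g s; split=> /= [h w sw _ -> | h w sw]; first exact: h.
exact: h sw _ erefl.
Qed.

Lemma upd_upd (D : Type) (g : var L -> D) x d e :
  upd (upd g x d) x e = upd g x e.
Proof. by apply/funext => z; rewrite /upd; case: eqP. Qed.

Lemma Casari_InqBQ x a : truth_conditional a -> InqBQ (Casari x a).
Proof.
move=> tc M g s t _ h d; apply/tc => w tw; apply: contrapT => naw; apply: (naw).
(* The premise at [d] yields [All x a] under [upd g x d]; its instance at [d] updates [x] a second
   time. *)
rewrite -(upd_upd g x d); apply: (h d) => [_ -> //|v vw va e].
(* Checked world by world, an empty [v] is vacuous; any [w'] in [v] is [w], so [va] contradicts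
   [naw]. *)
apply/tc => w' vw'; have ww' := vw _ vw'.
by case: naw; rewrite -ww'; move/tc: va; apply.
Qed.

End Casari.

Theorem theorem1 (L : language) (P : pred_sym L) (hP : arity P = 1)
    (x : var L) :
  IQC (All x ((Neg (Neg (Atom1 hP x)) ~> All x (Neg (Neg (Atom1 hP x))))
                ~> All x (Neg (Neg (Atom1 hP x))))
         ~> All x (Neg (Neg (Atom1 hP x))))%inq
  /\
  InqBQ (All x ((Atom1 hP x ~> All x (Atom1 hP x)) ~> All x (Atom1 hP x))
           ~> All x (Atom1 hP x))%inq.
Proof.
split; first exact: Casari_NegNeg_IQC.
exact: Casari_InqBQ (truth_conditional_Atom _).
Qed.
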